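(* Let $n$ be a positive integer and let $\alpha=(a_1,\dots,a_n)\in \mathrm{PF}_n$ be a parking function. Then the parking game $c_\alpha$ is supermodular, i.e. $$c_\alpha(S\cup\{i\})-c_\alpha(S)\le c_\alpha(T\cup\{i\})-c_\alpha(T)$$ for all $i\in[n]$ and all $S\subseteq T\subseteq[n]\setminus\{i\}$.
   Context: Write $[k]=\{1,\dots,k\}$. Parking process: there is a one-way street with $m$ spots numbered $1,\dots,m$, and $k\le m$ cars $1,\dots,k$ arrive one at a time in this order, with preferences $\beta=(b_1,\dots,b_k)\in[m]^k$. Upon arrival, car $i$ parks in the first unoccupied spot at or past $b_i$, if one exists; otherwise the process fails. $\mathrm{PF}_{k,m}\subseteq[m]^k$ is the set of tuples for which all cars are able to park, and $\mathrm{PF}_n=\mathrm{PF}_{n,n}$ is the set of parking functions of length $n$. For $\beta\in \mathrm{PF}_{k,m}$, with car $i$ parking in spot $p_i$, the total displacement is $d(\beta)=\sum_{i=1}^k(p_i-b_i)$, a nonnegative integer (it is $0$ for the empty tuple). The total displacement does not depend on the order of the entries of $\beta$. Parking game: for $\alpha=(a_1,\dots,a_n)\in \mathrm{PF}_n$, the parking game of $\alpha$ is the function $c_\alpha$ on subsets of $[n]$ given by $c_\alpha(S)=d((a_i:i\in S))$, the total displacement of the tuple $(a_i:i\in S)\in \mathrm{PF}_{|S|,n}$ (cars of $S$ parking on a street with $n$ spots). *)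

(* Defs.v *)
From mathcomp Require Import all_boot all_order all_algebra.
Set Implicit Arguments.
Unset Strict Implicit.
Unset Printing Implicit Defensive.

(* The spots 1, ..., m of the street and the cars 1, ..., k are represented by
   the ordinals 0, ..., m - 1 of 'I_m and 0, ..., k - 1 of 'I_k.  Displacements
   are differences of spots, hence unaffected by this shift. *)

(* [enum 'I_m] is increasing, so the head of the filtered list is the first
   suitable spot. *)
Definition first_free (m : nat) (occ : seq 'I_m) (b : 'I_m) : option 'I_m :=
  ohead [seq p : 'I_m <- enum 'I_m | (b <= p) && (p \notin occ)].

(* [park_from occ bs] is [Some ps], with [ps] the spots taken by the successive
   cars of preferences [bs] when the spots of [occ] are already occupied, and
   [None] if some car is unable to park. *)
Fixpoint park_from (m : nat) (occ bs : seq 'I_m) : option (seq 'I_m) :=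
  if bs is b :: bs' then
    if first_free occ b is Some p then
      if park_from (p :: occ) bs' is Some ps then Some (p :: ps) else None
    else None
  else Some [::].

Definition park (m : nat) (bs : seq 'I_m) : option (seq 'I_m) :=
  park_from [::] bs.

Definition PF (k m : nat) : {set k.-tuple 'I_m} :=
  [set beta : k.-tuple 'I_m | isSome (park beta)].

(* The value 0 on a tuple for which the process fails is a convention; by
   [restrict_PF] it is never used in [parking_game].  The truncated subtraction
   is exact, since a car never parks before its preferred spot. *)
Definition displacement (k m : nat) (beta : k.-tuple 'I_m) : nat :=
  if park beta is Some ps then \sum_(bp <- zip beta ps) (bp.2 - bp.1) else 0.

(* The tuple (a_i : i in S), with the cars of S in their original order. *)
Definition restrict (n : nat) (T : Type) (alpha : n.-tuple T) (S : {set 'I_n}) :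
    #|S|.-tuple T :=
  map_tuple (tnth alpha) (enum_tuple S).

Definition parking_game (n : nat) (alpha : n.-tuple 'I_n) (S : {set 'I_n}) :
    nat :=
  displacement (restrict alpha S).

Definition supermodular (R : numDomainType) (I : finType) (f : {set I} -> R) :
    Prop :=
  forall (i : I) (S T : {set I}), S \subset T -> T \subset [set~ i] ->
    (f (S :|: [set i]) - f S <= f (T :|: [set i]) - f T)%R.

Lemma first_freeP (m : nat) (occ : seq 'I_m) (b : 'I_m) :
  match first_free occ b with
  | Some p => [/\ b <= p, p \notin occ &
                 forall q : 'I_m, b <= q -> q \notin occ -> p <= q]
  | None => forall q : 'I_m, b <= q -> q \in occ
  end.
Proof.
rewrite /first_free.
have srt : sorted (fun i j : 'I_m => i <= j)
    [seq p : 'I_m <- enum 'I_m | (b <= p) && (p \notin occ)].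
  apply: sorted_filter => [x y z|]; first exact: leq_trans.
  by have := iota_sorted 0 m; rewrite -val_enum_ord sorted_map.
have mem q : (q \in [seq p : 'I_m <- enum 'I_m | (b <= p) && (p \notin occ)])
    = (b <= q) && (q \notin occ) by rewrite mem_filter mem_enum andbT.
move: srt mem.
case: [seq p : 'I_m <- enum 'I_m | _] => [_ mem q bq|p s srt mem] /=.
  by have := mem q; rewrite in_nil bq /= => /esym/negbFE.
have /andP[bp pocc] : (b <= p) && (p \notin occ) by rewrite -mem mem_head.
split=> // q bq qocc.
have : q \in p :: s by rewrite mem bq.
rewrite inE => /predU1P[->//|qs].
have tr : transitive (fun i j : 'I_m => i <= j) by move=> x y z; exact: leq_trans.
by move: srt => /= /(order_path_min tr)/allP; apply.
Qed.

Lemma park_from_subseq (m : nat) (bs bs' occ occ' : seq 'I_m) :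
  subseq bs' bs -> {subset occ' <= occ} ->
  isSome (park_from occ bs) -> isSome (park_from occ' bs').
Proof.
elim: bs bs' occ occ' => [|b bs IH] [|b' bs'] occ occ' //=.
have := first_freeP occ b; case: first_free => // p [bp pocc pmin].
move=> sub socc; case E: (park_from _ bs) => [ps|] // _.
have {E} parkE : isSome (park_from (p :: occ) bs) by rewrite E.
move: sub; case: eqVneq => [->|_] sub; last first.
  have /= := IH (b' :: bs') (p :: occ) occ' sub; apply => // q /socc qo.
  by rewrite inE qo orbT.
have := first_freeP occ' b; case: first_free => [p' [bp' p'occ p'min]|].
  suff /(IH _ _ _ sub)/(_ parkE) : {subset p' :: occ' <= p :: occ}.
    by case: park_from.
  move=> q; rewrite !inE => /predU1P[->|/socc->]; last by rewrite orbT.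
  case: (boolP (p' \in occ)) => [|p'o]; first by rewrite orbT.
  rewrite orbF -val_eqE eqn_leq pmin // andbT p'min //.
  by apply: contra pocc => /socc.
by move=> /(_ p bp)/socc; rewrite (negbTE pocc).
Qed.

Lemma restrict_PF (n : nat) (alpha : n.-tuple 'I_n) (S : {set 'I_n}) :
  alpha \in PF n n -> restrict alpha S \in PF #|S| n.
Proof.
rewrite !inE; apply: park_from_subseq => //=.
rewrite -[X in subseq _ X]map_tnth_enum; apply: map_subseq.
by rewrite {1}/enum_mem -enumT filter_subseq.
Qed.

(* Main.v *)
Require Import Defs.
From mathcomp Require Import all_boot all_order all_algebra.
From mathcomp Require Import zify.

(** The total displacement is the sum over the spots [j] of the number of cars
    that reach [j] from [j - 1].  If [c k] cars prefer spot [k], these flows [e j]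
    satisfy [e (j + 1) = max (e j + c j - 1) 0]: a spot left empty is passed by
    no car.  The counts [c k] are modular in the set of cars, and
    [x |-> max (x - 1) 0] is convex and nondecreasing, so by induction on [j]
    every flow is nondecreasing and supermodular, and so is their sum. *)

Set Implicit Arguments.
Unset Strict Implicit.
Unset Printing Implicit Defensive.

Fixpoint overflow (c : nat -> nat) (j : nat) : nat :=
  if j is j'.+1 then (overflow c j' + c j').-1 else 0.

Lemma overflow_supermodular (a b c d : nat -> nat) (j : nat) :
  (forall k, a k <= b k) -> (forall k, a k <= c k) ->
  (forall k, b k + c k = a k + d k) ->
  overflow b j + overflow c j <= overflow a j + overflow d j.
Proof.
move=> ab ac bcad.
(* The two monotonicity claims carry the induction: truncation at 0 preserves
   [x_b + x_c <= x_a + x_d] when [x_a] is at most [x_b] and [x_c], but turns [0 + 2 <= 1 + 1] into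
   [0 + 1 <= 0 + 0]. *)
suff: [/\ overflow a j <= overflow b j, overflow a j <= overflow c j &
    overflow b j + overflow c j <= overflow a j + overflow d j] by case.
elim: j => [|j [IHb IHc IHd]] //=.
by have [[]] := (ab j, ac j, bcad j); split; lia.
Qed.

Section Parking.

Variable m : nat.
Implicit Types (occ bs ps : seq 'I_m).

Lemma park_from_size occ bs ps :
  park_from occ bs = Some ps -> size ps = size bs.
Proof.
elim: bs occ ps => [|b bs IH] occ ps /=; first by case=> <-.
case: first_free => // p; case E: park_from => [qs|] // [<-] /=.
by rewrite (IH _ _ E).
Qed.

Lemma park_from_uniq occ bs ps :
  park_from occ bs = Some ps -> uniq ps && ~~ has (mem occ) ps.
Proof.
elim: bs occ ps => [|b bs IH] occ ps /=; first by case=> <-.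
have := first_freeP occ b; case: first_free => // p [_ pocc _].
case E: park_from => [qs|] // [<-] /=.
have /andP[-> /hasPn nqs] := IH _ _ E; rewrite andbT negb_or pocc /=.
apply/andP; split; first by apply/negP => /nqs; rewrite /= mem_head.
by apply/hasPn => q /nqs /=; rewrite inE negb_or => /andP[].
Qed.

Lemma park_from_ge occ bs ps :
  park_from occ bs = Some ps -> all (fun bp : 'I_m * 'I_m => bp.1 <= bp.2) (zip bs ps).
Proof.
elim: bs occ ps => [|b bs IH] occ ps /=; first by case=> <-.
have := first_freeP occ b; case: first_free => // p [bp _ _].
by case E: park_from => [qs|] // [<-] /=; rewrite bp (IH _ _ E).
Qed.

(** The spot [q] is free throughout, so a car reaching it would have parked there. *)
Lemma park_from_empty_spot occ bs ps (q : 'I_m) :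
  park_from occ bs = Some ps -> q \notin occ -> q \notin ps ->
  ~~ has (fun bp : 'I_m * 'I_m => bp.1 <= q < bp.2) (zip bs ps).
Proof.
elim: bs occ ps => [|b bs IH] occ ps /=; first by case=> <-.
have := first_freeP occ b; case: first_free => // p [_ _ pmin].
case E: park_from => [qs|] // [<-] qocc /=.
rewrite inE !negb_or => /andP[qp qqs]; apply/andP; split.
  by apply/negP => /andP[/pmin/(_ qocc)]; rewrite leqNgt => /negP.
by apply: (IH _ _ E) => //; rewrite inE negb_or qp.
Qed.

Lemma park_overflow bs ps (j : nat) : park bs = Some ps -> j <= m ->
  count (fun bp : 'I_m * 'I_m => bp.1 < j <= bp.2) (zip bs ps) =
  overflow (fun k => count (fun b : 'I_m => b == k :> nat) bs) j.
Proof.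
move=> parkE; elim: j => [|j IH] jm /=.
  by apply/eqP; rewrite eqn0Ngt -has_count; apply/hasPn.
rewrite -{}IH 1?ltnW //.
have szE := park_from_size parkE; have gE := park_from_ge parkE.
have /andP[psU _] := park_from_uniq parkE.
(* Conservation at spot [j]: the cars arriving from the left or preferring [j] either drive on or
   park at [j]. *)
have E1 : count (fun bp : 'I_m * 'I_m => bp.1 < j <= bp.2) (zip bs ps)
    + count (fun b : 'I_m => b == j :> nat) bs
  = count (fun bp : 'I_m * 'I_m => bp.1 < j.+1 <= bp.2) (zip bs ps)
    + count (fun p : 'I_m => p == j :> nat) ps.
  elim: bs ps szE gE {parkE psU} => [|b bs IH] [|p ps] //= [szE] /andP[bp gE].
  have {IH} := IH _ szE gE.
  have : (b < j <= p) + (b == j :> nat) = (b < j.+1 <= p) + (p == j :> nat) by lia.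
  by move: (b < j <= p) => u; lia.
have E2 : count (fun p : 'I_m => p == j :> nat) ps = (Ordinal jm \in ps).
  by rewrite -count_uniq_mem //; apply: eq_count.
rewrite {}E1 {}E2; case: (boolP (_ \in _)) => [_|jps]; first by rewrite addn1.
(* If [j] stays empty, no car drives past it, and the truncated predecessor of 0 is again 0. *)
have := park_from_empty_spot parkE isT jps.
by rewrite has_count -eqn0Ngt => /eqP ->.
Qed.

(** Double counting: a car going from [b] to [p] enters the [p - b] spots [j] with [b < j <= p]. *)
Lemma displacement_overflow (k : nat) (beta : k.-tuple 'I_m) :
  beta \in PF k m ->
  displacement beta =
  \sum_(j < m) overflow (fun i => count (fun b : 'I_m => b == i :> nat) beta) j.
Proof.
rewrite inE /displacement; case E: park => [ps|] // _.
under [RHS]eq_bigr => j _ do rewrite -(park_overflow E (ltnW (ltn_ord j))) -sum1_count.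
under [RHS]eq_bigr => j _ do rewrite big_mkcond.
rewrite exchange_big /=; apply: eq_bigr => -[b p] _ /=.
(* The bound is freed for induction; at [l = m] the minimum is [p], since [p < m]. *)
have sumE l : \sum_(0 <= j < l) (if b < j <= p then 1 else 0) = minn l.-1 p - b.
  elim: l => [|l IH]; first by rewrite big_nil min0n.
  by rewrite big_nat_recr //= IH; case: ifP; lia.
by rewrite -(big_mkord xpredT (fun j => if b < j <= p then 1 else 0)) sumE;
  have := ltn_ord p; lia.
Qed.

End Parking.

Lemma count_restrict (n : nat) (T : Type) (alpha : n.-tuple T) (P : pred T)
    (S : {set 'I_n}) :
  count P (restrict alpha S) = \sum_(i in S) P (tnth alpha i).
Proof.
rewrite /= count_map -sum1_count big_enum_cond /= big_mkcondr /=.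
by apply: eq_bigr => i _; case: (P _).
Qed.

Theorem lemma3p5 (n : nat) (hn : 0 < n) (alpha : n.-tuple 'I_n)
    (halpha : alpha \in PF n n) :
  supermodular (fun S : {set 'I_n} => Posz (parking_game alpha S)).
Proof.
move=> i S T sST sTi.
have iT : i \notin T by apply/negP => /(subsetP sTi); rewrite !inE eqxx.
have iS : i \notin S by apply: contra iT; exact: (subsetP sST).
suff : parking_game alpha T + parking_game alpha (S :|: [set i])
    <= parking_game alpha S + parking_game alpha (T :|: [set i]) by lia.
rewrite /parking_game !displacement_overflow ?restrict_PF // -!big_split /=.
(* Here [a], [b], [c], [d] count the cars preferring each spot in [S], [T], [S] with [i], and [T]
   with [i]. *)
apply: leq_sum => j _; apply: overflow_supermodular => k;
  rewrite !count_restrict ?[_ :|: [set i]]setUC ?big_setU1 //=.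
- by rewrite [leqRHS](big_setID S) /= (setIidPr sST) leq_addr.
- by rewrite leq_addl.
- by rewrite addnCA [RHS]addnCA; congr addn; rewrite addnC.
Qed.
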